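(* Let $G=(V,E)$ be a graph on $n$ vertices with minimum degree $m$, where $m\to\infty$ as $n\to\infty$. For every $\varepsilon>0$ there exists a constant $k_\varepsilon$ such that if $k\geq k_\varepsilon$ then with high probability $G_k$ contains a path of length at least $(1-\varepsilon)m$.
   Context: For a fixed graph $G=(V,E)$ and a positive integer $k$, the random graph $G_k$ is obtained by letting each vertex $v\in V$ independently choose $k$ random neighbors of $v$ in $G$ (uniformly from its $G$-neighborhood), the edges of $G_k$ being all pairs $\{v,w\}$ such that $v$ chose $w$ or $w$ chose $v$. $G$ is one member of a sequence of graphs with $n\to\infty$; ''with high probability'' means with probability tending to $1$ as $n\to\infty$ (equivalently, as $m\to\infty$). *)

(* Defs.v *)
From HB Require Import structures.
From mathcomp Require Import all_boot all_order all_algebra.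
From mathcomp Require Import reals.
Set Implicit Arguments. Unset Strict Implicit. Unset Printing Implicit Defensive.
Import Order.TTheory GRing.Theory Num.Theory.

Definition simple_graph (T : finType) (e : rel T) : Prop :=
  symmetric e /\ irreflexive e.

Definition deg (T : finType) (e : rel T) (v : T) : nat := #|[set w | e v w]|.

(* minimum degree (0 for the empty graph) *)
Definition mindeg (T : finType) (e : rel T) : nat :=
  \big[minn/#|T|]_(v : T) deg e v.

(* An outcome of the k-out experiment: vertex v makes its i-th choice
   f (v, i) (choices made independently, with replacement). *)
Definition choice_fun (T : finType) (k : nat) := {ffun T * 'I_k -> T}.

Definition valid_choice (T : finType) (e : rel T) (k : nat)
  (f : choice_fun T k) : bool :=
  [forall x : T * 'I_k, e x.1 (f x)].

Definition Gk_edge (T : finType) (k : nat) (f : choice_fun T k) : rel T :=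
  fun v w => [exists i : 'I_k, (f (v, i) == w) || (f (w, i) == v)].

(* Probability of event A in G_k: each vertex picks each of its k choices
   uniformly and independently from its G-neighbourhood, so the outcome is
   uniformly distributed over the valid choice functions. *)
Definition Gk_prob (R : realType) (T : finType) (e : rel T) (k : nat)
  (A : pred (choice_fun T k)) : R :=
  (#|[set f : choice_fun T k | valid_choice e f && A f]|%:R / #|[set f : choice_fun T k | valid_choice e f]|%:R)%R.

(* The graph with edge relation r contains a path of length (number of edges)
   at least L: distinct vertices x, t_1, ..., t_n with consecutive ones
   adjacent and n >= L (n < #|T| automatically since vertices are distinct). *)
Definition has_path_of_length_ge (R : realType) (T : finType) (r : rel T)
  (L : R) : bool :=
  [exists n : 'I_#|T|, exists x : T, exists t : n.-tuple T,
     [&& uniq (x :: t), path r x t & (L <= (n : nat)%:R)%R]].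

(* Main.v *)
(* Run a depth-first search on G_k, revealing the random choices one at a time,
   and let D be the set of vertices that left the stack P, all of whose k
   choices are then known. Put d = m / q with q of order 1/eps. As long as
   fewer than k d choices are revealed, #|D| < d, so if P never gets longer
   than m - 2d, at least a fraction 1/(2q) of the possible values of the next
   choice are new vertices. Hence E[2^-(number of successful choices)] after
   k d choices is at most (1 - 1/(4q))^(k d), whereas at most m successes fit in
   D and P: the failure probability is at most 2^m (1 - 1/(4q))^(k d), which is
   at most 2^-d for large k. No union bound over the (arbitrarily many) vertices
   of G is needed. *)
Require Import Defs.
From HB Require Import structures.
From mathcomp Require Import all_boot all_order all_algebra.
From mathcomp Require Import reals.
From mathcomp Require Import zify ring lra.
Import Order.TTheory GRing.Theory Num.Theory.
Local Open Scope ring_scope.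

(** * Revealing one coordinate of a product set of outcomes *)

Definition pin {X T : finType} (F : X -> {set T}) (x : X) (w : T) : X -> {set T} :=
  [eta F with x |-> [set w]].

Lemma pin_sub {X T : finType} (F : X -> {set T}) {x w} y :
  w \in F x -> pin F x w y \subset F y.
Proof. by move=> wF; rewrite /pin /=; case: (eqVneq y x) => [->|_]; rewrite ?sub1set. Qed.

(** The number of outcomes left after revealing choice [x] does not depend on the value [w]:
    uniformity of the choice, in counting form. *)
Lemma card_family_pin {X T : finType} (F : X -> {set T}) x w :
  (#|F x| * #|family (pin F x w)| = #|family F|)%N.
Proof.
rewrite !card_family !foldrE !big_image /=.
rewrite [RHS](bigD1 x) //= [in LHS](bigD1 x) //= /pin /= eqxx cards1 mul1n; congr (_ * _)%N.
by apply: eq_bigr => y /negPf ->.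
Qed.

(** Law of total probability over the value at [x], as a count. *)
Lemma card_family_split {X T : finType} (F : X -> {set T}) x
    (A : pred {ffun X -> T}) :
  #|[set f in family F | A f]| =
  (\sum_(w in F x) #|[set f in family (pin F x w) | A f]|)%N.
Proof.
rewrite -sum1_card (partition_big (fun f : {ffun X -> T} => f x) (mem (F x))) /=; last first.
  by move=> f; rewrite inE => /andP[/familyP/(_ x)].
apply: eq_bigr => w wF; rewrite -sum1_card; apply: eq_bigl => f.
rewrite !in_set andbAC; congr (_ && _).
apply/andP/familyP => [[/familyP fF /eqP fx] y|fF] /=.
  by rewrite /pin /=; case: (eqVneq y x) => [->|_]; rewrite ?inE ?fx.
split; last by move: (fF x); rewrite /pin /= eqxx inE.
by apply/familyP => y; apply: (subsetP (pin_sub _ _ wF)); exact: fF.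
Qed.

(** * Search states and the edges they force *)

(* [F (v, i)] is the set of values that choice [i] of [v] can still take: it is
   the whole neighbourhood of [v] until the choice is revealed, and then a
   singleton. *)
Definition forced {T : finType} {k : nat} (F : T * 'I_k -> {set T}) : rel T :=
  fun w v => [exists i, F (v, i) \subset [set w]].

Lemma forced_edge {T : finType} {k : nat} (F : T * 'I_k -> {set T})
    (f : choice_fun T k) :
  f \in family F -> subrel (forced F) (Gk_edge f).
Proof.
move=> /familyP fF w v /existsP[i /subsetP Fi]; apply/existsP; exists i.
by have := Fi _ (fF (v, i)); rewrite inE => /eqP ->; rewrite eqxx orbT.
Qed.

Lemma forced_pin {T : finType} {k : nat} (F : T * 'I_k -> {set T}) {x w} :
  w \in F x -> subrel (forced F) (forced (pin F x w)).
Proof.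
move=> wF u v /existsP[i Fi]; apply/existsP; exists i.
exact: subset_trans (pin_sub _ _ wF) Fi.
Qed.

Lemma onem_natV_ge0 {R : realFieldType} {n : nat} :
  (0 < n)%N -> 0 <= 1 - n%:R^-1 :> R.
Proof. by move=> n0; rewrite subr_ge0 invf_le1 ?ler1n ?ltr0n. Qed.

(* [Q] is the set of revealed choices; the head of [P] is the top of the stack. *)
Record dfs_state {T : finType} {k : nat} (e : rel T) (F : T * 'I_k -> {set T})
    (Q : {set T * 'I_k}) (P : seq T) (D : {set T}) : Prop := DfsState {
  dfs_uniq : uniq P;
  dfs_disj : {in P, forall v, v \notin D};
  dfs_path : sorted (forced F) P;
  dfs_dead : forall v i, v \in D -> (v, i) \in Q;
  dfs_free : forall y, y \notin Q -> F y = [set w | e y.1 w] }.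
Arguments dfs_uniq {T k e F Q P D}.
Arguments dfs_disj {T k e F Q P D}.
Arguments dfs_path {T k e F Q P D}.
Arguments dfs_dead {T k e F Q P D}.
Arguments dfs_free {T k e F Q P D}.

(** Discarded vertices have used up all [k] choices; this keeps [D] below [d] while fewer than
    [k * d] choices are known. *)
Lemma card_dead {T : finType} {k : nat} {e : rel T} {F : T * 'I_k -> {set T}}
    {Q P D} : dfs_state e F Q P D -> (#|D| * k <= #|Q|)%N.
Proof.
case=> _ _ _ dead _; rewrite -[k in X in (X <= _)%N]card_ord -cardsT -cardsX.
by apply/subset_leq_card/subsetP => -[v i]; rewrite !inE andbT; exact: dead.
Qed.

(* Induction on the number [r] of choices still to be revealed; the factor
   [2 ^+ (m - d - _)] halves at each success. *)
Lemma few_outcomes {R : realFieldType} {T : finType} {k : nat} {e : rel T}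
    {m d q : nat} {A : pred (choice_fun T k)} :
  (0 < d)%N -> (2 * d <= m)%N -> (m <= 2 * q * d)%N -> (m <= #|T|)%N ->
  (forall v, (m <= deg e v)%N) ->
  (forall f v P, A f -> uniq (v :: P) -> path (Gk_edge f) v P ->
     (size P < m - 2 * d)%N) ->
  forall r F Q P D, dfs_state e F Q P D -> (#|Q| + r = k * d)%N ->
  #|[set f in family F | A f]|%:R <=
    2 ^+ (m - d - (#|D| + size P)) * (1 - (4 * q)%:R^-1) ^+ r
      * #|family F|%:R :> R.
Proof.
move=> d0 dm mq mT mdeg short.
have q0 : (0 < q)%N by case: q mq => //; lia.
set c : R := 1 - _.
have c0 : 0 <= c.
  by apply: onem_natV_ge0; lia.
elim=> [|r IHr] F Q P D + Qr.
  move=> _; rewrite expr0 mulr1; apply: (@le_trans _ _ #|family F|%:R).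
    by rewrite ler_nat; apply/subset_leq_card/subsetP => f; rewrite inE => /andP[].
  by rewrite ler_peMl // -natrX ler1n expn_gt0.
have query : forall (D : {set T}) v P' i, dfs_state e F Q (v :: P') D -> (v, i) \notin Q ->
    #|[set f in family F | A f]|%:R <=
      2 ^+ (m - d - (#|D| + (size P').+1)) * c ^+ r.+1 * #|family F|%:R :> R.
  move=> {P D} D v P' i st viQ.
  (* A stack this long is a path in every outcome of [family F], so none of them lies in [A]. *)
  have [Plong|Pshort] := ltnP (m - 2 * d)%N (size P').+1.
    rewrite (_ : [set f in _ | _] = set0) ?cards0 ?mulr_ge0 ?exprn_ge0 //.
    apply/setP => f; rewrite in_set in_set0; apply/negP => /andP[fF Af].
    have vP := sub_path (forced_edge _ _ fF) (dfs_path st).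
    by have := short f v P' Af (dfs_uniq st) vP; rewrite ltnNge -ltnS Plong.
  have Dd : (#|D| < d)%N.
    have := card_dead st; have k0 : (0 < k)%N := leq_ltn_trans (leq0n i) (ltn_ord i).
    have : (#|Q| < k * d)%N by lia.
    nia.
  set a := (#|D| + _)%N; set b := (m - d - a)%N.
  (* With truncated subtraction, positivity is what lets the exponent drop at a success. *)
  have b0 : (0 < b)%N by rewrite /b /a; lia.
  set x := (v, i); set V := F x.
  have VE : V = [set w | e v w] by rewrite /V (dfs_free st).
  have mV : (m <= #|V|)%N by rewrite VE; exact: mdeg.
  set G := [set w in V | (w \notin D) && (w \notin v :: P')].
  (* [G] holds the successes. Since [a < m - d], [#|G|] exceeds [#|V| - m + d]; conclude by
     [m <= 2 * q * d] and [m <= #|V|]. *)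
  have Gbig : (#|V| <= 2 * q * #|G|)%N.
    have : (#|V| <= #|G| + a)%N.
      have : V \subset G :|: (D :|: [set w in v :: P']).
        apply/subsetP => w wV; rewrite !inE wV /=.
        by case: (w \in D); case: (w == v); case: (w \in P').
      move=> /subset_leq_card /leq_trans; apply.
      rewrite (leq_trans (leq_card_setU _ _)) // leq_add2l.
      rewrite (leq_trans (leq_card_setU _ _)) // leq_add2l.
      by rewrite cardsE; exact: card_size.
    by move: b0; rewrite /b; nia.
  have V0 : 0 < #|V|%:R :> R by rewrite ltr0n; lia.
  set K : R := #|family F|%:R / #|V|%:R.
  have K0 : 0 <= K by rewrite divr_ge0.
  have KE w : #|family (pin F x w)|%:R = K.
    by rewrite /K -(card_family_pin F x w) natrM mulrAC divff ?mul1r ?gt_eqF.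
  have famE : #|family F|%:R = #|V|%:R * K by rewrite mulrC divfK ?gt_eqF.
  clearbody K.
  have step w : w \in V -> #|[set f in family (pin F x w) | A f]|%:R <=
      2 ^+ b * c ^+ r * K * (1 - (w \in G)%:R / 2) :> R.
    move=> wV.
    have Q1 : #|x |: Q| = #|Q|.+1 by have := cardsU1 x Q; rewrite viQ.
    have Q' : (#|x |: Q| + r = k * d)%N by rewrite Q1 -Qr addnS.
    have dead' u j : u \in D -> (u, j) \in x |: Q.
      by move=> uD; rewrite inE (dfs_dead st) ?orbT.
    have free' y : y \notin x |: Q -> pin F x w y = [set w | e y.1 w].
      rewrite !inE negb_or /pin /= => /andP[/negPf-> yQ].
      exact: (dfs_free st).
    have path' : path (forced (pin F x w)) v P'.
      exact: sub_path (forced_pin _ wV) _ _ (dfs_path st).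
    have [wG|wG] := boolP (w \in G).
      have := wG; rewrite !inE => /andP[_ /andP[wD wP]].
      have st' : dfs_state e (pin F x w) (x |: Q) (w :: v :: P') D.
        split=> //; first by rewrite cons_uniq inE wP (dfs_uniq st).
          by move=> u; rewrite inE => /predU1P[->//|]; exact: (dfs_disj st).
        apply/andP; split=> //; apply/existsP; exists i.
        by rewrite /pin /= eqxx.
      apply: le_trans (IHr _ _ _ _ st' Q') _; rewrite KE /= le_eqVlt; apply/orP; left.
      rewrite -/c (_ : b = (m - d - (#|D| + (size P').+2)).+1); last first.
        by move: b0; rewrite /b /a; lia.
      by apply/eqP; rewrite exprS; field.
    have st' : dfs_state e (pin F x w) (x |: Q) (v :: P') D.
      split=> //; first exact: (dfs_uniq st).
      exact: (dfs_disj st).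
    apply: le_trans (IHr _ _ _ _ st' Q') _; rewrite KE /=.
    by rewrite mul0r subr0 mulr1.
  rewrite (card_family_split F x) natr_sum; apply: le_trans (ler_sum _ step) _.
  rewrite -mulr_sumr exprSr !mulrA -!(mulrA (_ * c ^+ r)) ler_wpM2l //.
    by rewrite mulr_ge0 ?exprn_ge0.
  (* Summing over [w] gives [#|V| - #|G| / 2], at most [#|V| * (1 - 1 / (4 * q))]. *)
  rewrite sumrB sumr_const -mulr_suml -natr_sum famE.
  have -> : (\sum_(w in V) (w \in G))%N = #|G|.
    rewrite -sum1_card big_mkcond [RHS]big_mkcond; apply: eq_bigr => w _.
    by rewrite !inE; case: (w \in V).
  rewrite [leLHS]mulrC mulrA ler_wpM2r // /c.
  have q0' : 0 < q%:R :> R by rewrite ltr0n.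
  have : #|V|%:R <= 2 * q%:R * #|G|%:R :> R by rewrite -!natrM ler_nat.
  rewrite -ler_pdivrMl ?mulr_gt0 //.
  have -> : (4 * q)%:R^-1 = (2 * q%:R)^-1 / 2 :> R by rewrite natrM; field; rewrite gt_eqF.
  lra.
(* Inner induction with [Q] fixed: popping an exhausted top into [D] keeps [#|D| + size P], hence
   the bound. *)
elim: P D => [|v P IHP] D st.
  have Dd : (#|D| < d)%N.
    have := card_dead st; nia.
  have : exists y, y \notin Q.
    apply/existsP; rewrite -negb_forall; apply/negP => /forallP QT.
    have : (#|{: T * 'I_k}| <= #|Q|)%N.
      by apply/subset_leq_card/subsetP => y _; exact: QT.
    by rewrite card_prod card_ord; nia.
  move=> [[v i] viQ].
  have vD : v \notin D by apply: contra viQ; exact: (dfs_dead st).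
  have st' : dfs_state e F Q [:: v] D.
    split=> //; first by move=> u; rewrite inE => /eqP->.
      exact: (dfs_dead st).
    exact: (dfs_free st).
  (* Opening a new stack adds a vertex without a success, which only lowers the exponent. *)
  apply: le_trans (query _ _ _ _ st' viQ) _; rewrite !ler_wpM2r ?exprn_ge0 //.
  by rewrite ler_weXn2l ?ler1n //=; lia.
have [/forallP vQ|] := boolP [forall i, (v, i) \in Q]; last first.
  by rewrite negb_forall => /existsP[i]; exact: query.
have vD : v \notin D by apply: (dfs_disj st); rewrite inE eqxx.
have st' : dfs_state e F Q P (v |: D).
  split.
  - by case/andP: (dfs_uniq st).
  - move=> u uP; rewrite !inE negb_or (dfs_disj st) ?inE ?uP ?orbT // andbT.
    by apply: contraTneq uP => ->; case/andP: (dfs_uniq st).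
  - exact: path_sorted (dfs_path st).
  - by move=> u i; rewrite !inE => /predU1P[->|]; [exact: vQ | exact: (dfs_dead st)].
  - exact: (dfs_free st).
by have := IHP _ st'; rewrite cardsU1 vD add1n addSnnS.
Qed.

(** * From counts to the probability of a long path *)

Lemma mindeg_le_deg {T : finType} (e : rel T) v : (mindeg e <= deg e v)%N.
Proof.
rewrite /mindeg; have := mem_index_enum v.
elim: (index_enum T) => // u s IHs; rewrite inE big_cons geq_min.
by case/predU1P => [->|/IHs ->]; rewrite ?leqnn ?orbT.
Qed.

Lemma mindeg_le_card {T : finType} (e : rel T) : (mindeg e <= #|T|)%N.
Proof.
rewrite /mindeg; elim: (index_enum T) => [|u s IHs]; first by rewrite big_nil.
by rewrite big_cons geq_min IHs orbT.
Qed.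

Lemma family_valid {T : finType} (e : rel T) k :
  [set f : choice_fun T k | valid_choice e f] =i
  family (fun x : T * 'I_k => [set w | e x.1 w]).
Proof.
move=> f; rewrite in_set; apply/forallP/familyP => H x; have := H x; by rewrite inE.
Qed.

Lemma has_pathP {R : realType} {T : finType} {r : rel T} {L : R} {v P} :
  uniq (v :: P) -> path r v P -> L <= (size P)%:R ->
  has_path_of_length_ge r L.
Proof.
move=> uP pP LP.
have sP : (size P < #|T|)%N by have := max_card (mem (v :: P)); rewrite (card_uniqP uP).
apply/existsP; exists (Ordinal sP); apply/existsP; exists v.
by apply/existsP; exists (in_tuple P); rewrite uP pP.
Qed.

(** The search starts with nothing revealed and makes [k * d] choices; [mindeg e <= 2 * q * d]
    bounds the initial power of 2 by [4 ^+ (q * d)]. *)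
Lemma path_prob {R : realType} {T : finType} {e : rel T} {k d q : nat} {L : R} :
  (0 < k)%N -> (0 < d)%N -> (2 * d <= mindeg e)%N -> (mindeg e <= 2 * q * d)%N ->
  L <= (mindeg e - 2 * d)%:R ->
  1 - (4 ^+ q * (1 - (4 * q)%:R^-1) ^+ k) ^+ d <=
    Gk_prob R e (fun f : choice_fun T k => has_path_of_length_ge (Gk_edge f) L).
Proof.
move=> k0 d0 dm mq Lm; set c : R := 1 - (4 * q)%:R^-1.
have q0 : (0 < q)%N by case: q mq {c} => //; lia.
have c0 : 0 <= c by apply: onem_natV_ge0; lia.
pose F x := [set w | e (x : T * 'I_k).1 w].
pose A (f : choice_fun T k) := ~~ has_path_of_length_ge (Gk_edge f) L.
have st : dfs_state e F set0 [::] set0 by split=> // u i; rewrite inE.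
have short f v P : A f -> uniq (v :: P) -> path (Gk_edge f) v P ->
    (size P < mindeg e - 2 * d)%N.
  move=> /negP Af uP pP; rewrite ltnNge; apply/negP => mP; apply: Af.
  by apply: has_pathP uP pP _; rewrite (le_trans Lm) // ler_nat.
have := few_outcomes (R := R) d0 dm mq (mindeg_le_card e) (mindeg_le_deg e) short
  (k * d) F set0 [::] set0 st.
rewrite !cards0 => /(_ erefl); rewrite -/c addn0 subn0 => few.
have fam0 : (0 < #|family F|)%N.
  rewrite card_family foldrE big_image prodn_gt0 //= => x.
  by have := mindeg_le_deg e x.1; rewrite /deg /F; lia.
rewrite /Gk_prob (eq_card (family_valid e k)) -/F.
set good := #|_|.
have tot : (good + #|[set f in family F | A f]| = #|family F|)%N.
  rewrite -[RHS](cardID A) addnC; congr (_ + _)%N.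
    by apply: eq_card => f; rewrite !in_set.
  apply: eq_card => f.
  change (f \in [set f | valid_choice e f
    & has_path_of_length_ge (Gk_edge f) L] =
    ~~ A f && (f \in family F)).
  by rewrite !in_set -(family_valid e k f) in_set /A negbK andbC.
rewrite ler_pdivlMr ?ltr0n //.
have le_pow : 2 ^+ (mindeg e - d) * c ^+ (k * d) <= (4 ^+ q * c ^+ k) ^+ d.
  rewrite exprMn -exprM -exprM ler_wpM2r ?exprn_ge0 //.
  have -> : 4 = 2 ^+ 2 :> R by rewrite -natrX.
  by rewrite -exprM ler_weXn2l ?ler1n // mulnA; lia.
have := le_trans few (ler_wpM2r (ler0n R _) le_pow).
have := congr1 (fun n => n%:R : R) tot; rewrite /= natrD.
lra.
Qed.

(** * Numerical estimates and choice of constants *)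

(** Bernoulli gives [(1 + 1/n) ^+ n >= 2], while [(1 - 1/n) ^+ n * (1 + 1/n) ^+ n <= 1]. *)
Lemma expr1B_le_half {R : realFieldType} {n : nat} :
  (0 < n)%N -> (1 - n%:R^-1) ^+ n <= 2^-1 :> R.
Proof.
move=> n0; set x : R := n%:R^-1.
have nR : 0 < n%:R :> R by rewrite ltr0n.
have x0 : 0 < x by rewrite invr_gt0.
have x1 : x <= 1 by rewrite invf_le1 // ler1n.
have bernoulli i : 1 + i%:R * x <= (1 + x) ^+ i.
  elim: i => [|i IHi]; first by rewrite mul0r addr0.
  have i0 : 0 <= i%:R :> R by [].
  rewrite exprS -natr1; nra.
have := bernoulli n; rewrite divff ?gt_eqF // => two.
have one : (1 - x) ^+ n * (1 + x) ^+ n <= 1.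
  by rewrite -exprMn exprn_ile1 //; nra.
have u0 : 0 <= (1 - x) ^+ n by rewrite exprn_ge0 // subr_ge0.
have := ler_wpM2l u0 two; lra.
Qed.

(** Each block of [4 * q] factors at least halves the product; [2 * q] blocks cancel [4 ^+ q] and
    one more gives the final half. *)
Lemma expr_le_half {R : realFieldType} {q k : nat} :
  (0 < q)%N -> (4 * q * (2 * q).+1 <= k)%N ->
  4 ^+ q * (1 - (4 * q)%:R^-1) ^+ k <= 2^-1 :> R.
Proof.
move=> q0 qk; set c : R := 1 - _.
have c01 : 0 <= c <= 1.
  by rewrite onem_natV_ge0 ?gerBl ?invr_ge0 ?ler0n; lia.
have [c0 c1] := andP c01.
have : c ^+ k <= 2^-1 ^+ (2 * q).+1.
  apply: le_trans (_ : c ^+ (4 * q * (2 * q).+1) <= _).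
    exact: ler_wiXn2l.
  rewrite exprM lerXn2r ?nnegrE ?exprn_ge0 ?invr_ge0 //.
  by apply: expr1B_le_half; lia.
move=> /(ler_wpM2l (exprn_ge0 q (ler0n R 4)))/le_trans; apply.
have -> : 4 = 2 ^+ 2 :> R by rewrite -natrX.
by rewrite -exprM exprSr mulrA -exprMn divff ?expr1n ?mul1r // pnatr_eq0.
Qed.

(* A sequence of graphs G_j = ('I_(nv j), e j), j : nat, with minimum degree
   m j -> oo.  For every eps > 0 there is k_eps such that for every k >= k_eps,
   P(G_k contains a path of length >= (1-eps) m) -> 1 as j -> oo. *)
Theorem theorem3 (R : realType) (nv : nat -> nat)
  (e : forall j : nat, rel 'I_(nv j)) :
  (forall j, simple_graph (e j)) ->
  (forall M : nat, exists J : nat, forall j : nat, (J <= j)%N ->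
      (M <= mindeg (e j))%N) ->
  forall eps : R, 0 < eps ->
  exists keps : nat, forall k : nat, (keps <= k)%N ->
    forall delta : R, 0 < delta ->
    exists J : nat, forall j : nat, (J <= j)%N ->
      1 - delta <=
      Gk_prob R (e j)
        (fun f : choice_fun 'I_(nv j) k =>
           has_path_of_length_ge (Gk_edge f)
             ((1 - eps) * (mindeg (e j))%:R)).
Proof.
move=> _ mindeg_oo eps eps0.
(* [q >= 2 / eps] makes the loss [2 * d] at most [eps * m]; the offset 2 gives [q >= 2], hence
   [2 * d <= m]. *)
pose q := (Num.bound (2 / eps)).+2.
have q_eps : 2 <= eps * q%:R.
  rewrite mulrC -ler_pdivrMr // (@le_trans _ _ (Num.bound (2 / eps))%:R) //.
    by rewrite ltW ?archi_boundP ?divr_ge0 ?(ltW eps0).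
  by rewrite ler_nat /q; lia.
exists (4 * q * (2 * q).+1)%N => k kq delta delta0.
(* This threshold makes [d] exceed [1 / delta], so that [2^-1 ^+ d <= delta]. *)
have [J mJ] := mindeg_oo (q * (Num.bound delta^-1).+1)%N.
exists J => j /mJ {mJ}; set m := mindeg (e j) => mM.
pose d := (m %/ q)%N.
have d_big : (Num.bound delta^-1 < d)%N by rewrite leq_divRL // mulnC.
have md : (m < q * d.+1)%N by rewrite mulnC -ltn_divLR.
have dm : (q * d <= m)%N by rewrite mulnC leq_divM.
have d0 : (0 < d)%N by lia.
have d2m : (2 * d <= m)%N by apply: leq_trans dm; rewrite leq_mul2r orbT.
have mq : (m <= 2 * q * d)%N by nia.
have L : (1 - eps) * m%:R <= (m - 2 * d)%:R.
  rewrite natrB // natrM.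
  have : q%:R * d%:R <= m%:R :> R by rewrite -natrM ler_nat.
  have : 0 <= d%:R :> R by [].
  nra.
apply: le_trans (path_prob _ d0 d2m mq L); last by lia.
rewrite lerD2l lerN2.
set y := _ * _.
have y2 : y <= 2^-1 by exact: expr_le_half.
have y0 : 0 <= y.
  by rewrite mulr_ge0 ?exprn_ge0 //; apply: onem_natV_ge0; lia.
apply: le_trans (_ : 2^-1 ^+ d <= _).
  by rewrite lerXn2r ?nnegrE ?invr_ge0.
rewrite exprVn invf_ple ?posrE ?exprn_gt0 // ltW //.
exact: upper_nthrootP (ltnW d_big).
Qed.
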